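(* Let $\Gamma$ be a finite group, $q=|\Gamma|$, $n\ge1$, $\mathcal{H}\le\Gamma^n$, and $r(E)=\log_q|\mathcal{H}|$. Then $$W_{\mathcal{R}(\mathcal{H})}(t)=\frac{(1+(q-1)t)^n}{q^{r(E)}}\,W_{\mathcal{H}}\Big(\frac{1-t}{1+(q-1)t}\Big).$$
   Context: For $h=(h_1,\dots,h_n)\in\mathcal{H}$, its weight is $w(h)=|\{i:h_i\ne1_\Gamma\}|$ and $W_{\mathcal{H}}(t)=\sum_{h\in\mathcal{H}}t^{w(h)}$. $\mathcal{R}(\mathcal{H})$ is the multiset of irreducible complex representations of $\Gamma^n$ whose direct sum is equivalent to the permutation representation on $\mathbb{C}[\Gamma^n/\mathcal{H}]$ ($g'\cdot g\mathcal{H}=g'g\mathcal{H}$). Each irreducible $\rho$ of $\Gamma^n$ is equivalent to $\rho_1\otimes\cdots\otimes\rho_n$, $\rho_i$ irreducible of $\Gamma$; $\mathrm{triv}(\rho)=\{i:\rho_i\text{ trivial}\}$, $w(\rho)=n-|\mathrm{triv}(\rho)|$, and $W_{\mathcal{R}(\mathcal{H})}(t)=\sum_{\rho\in\mathcal{R}(\mathcal{H})}(\dim\rho)\,t^{w(\rho)}$, the sum taken over the multiset (with multiplicity). *)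

(* Defs.v *)
From HB Require Import structures.
From mathcomp Require Import all_boot all_order all_fingroup all_algebra.
From mathcomp Require Import mxrepresentation character fraction complex.
From mathcomp Require Import boolp reals exp.

Set Implicit Arguments.
Unset Strict Implicit.
Unset Printing Implicit Defensive.

Import Order.TTheory GRing.Theory Num.Theory.
Local Open Scope ring_scope.

(* The power Gamma^n, with the pointwise group structure of gproduct.v. *)
Notation gpow gT n := {dffun forall _ : 'I_n, gT}.

Section CodeWeight.
Variables (gT : finGroupType) (n : nat).

Definition code_weight (h : gpow gT n) : nat := #|[set i | h i != 1%g]|.

(* The enumerators are functions on an arbitrary field, so that they can be
   evaluated at an indeterminate or at a rational function. *)
Definition code_enum (K : fieldType) (H : {group gpow gT n}) (t : K) : K :=
  \sum_(h in H) t ^+ code_weight h.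

(* If gT is trivial, this is 0 / 0 = 0. *)
Definition log_rank (R : realType) (H : {group gpow gT n}) : R :=
  ln #|H|%:R / ln #|gT|%:R.

End CodeWeight.

Section Representations.
Variables (F : fieldType) (gT : finGroupType) (G : {group gT}).

Lemma one_mx_repr : mx_repr G (fun _ : gT => 1%:M : 'M[F]_1).
Proof. by split=> // x y _ _; rewrite mulmx1. Qed.

Definition one_grepr : representation F G :=
  Representation (MxRepresentation one_mx_repr).

Definition prod_grepr (r1 r2 : representation F G) :
  representation F G := Representation (prod_repr r1 r2).

End Representations.

Section TensorFactors.
Variables (F : fieldType) (gT : finGroupType) (n : nat).

Lemma proj_mx_repr (i : 'I_n) (r : representation F [set: gT]%G) :
  mx_repr [set: gpow gT n]%G (fun g : gpow gT n => r (g i)).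
Proof.
split=> [|x y _ _]; first by rewrite oneg_ffun repr_mx1.
by rewrite mulg_ffun repr_mxM ?inE.
Qed.

Definition proj_grepr (i : 'I_n) (r : representation F [set: gT]%G) :
    representation F [set: gpow gT n]%G :=
  Representation (MxRepresentation (proj_mx_repr i r)).

(* g |-> r_0 (g 0) (x) ... (x) r_(n-1) (g (n-1)). *)
Definition tensor_grepr (r : 'I_n -> representation F [set: gT]%G) :
    representation F [set: gpow gT n]%G :=
  \big[@prod_grepr F _ _/one_grepr F _]_(i < n) proj_grepr i (r i).

Definition tensor_factors (rho : representation F [set: gpow gT n]%G)
    (r : 'I_n -> representation F [set: gT]%G) : Prop :=
  (forall i, mx_irreducible (r i)) /\ mx_rsim rho (tensor_grepr r).

(* The factors of an irreducible rho are unique up to equivalence when F is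
   algebraically closed, so the choice of r does not matter. *)
Definition triv_set (rho : representation F [set: gpow gT n]%G) : {set 'I_n} :=
  [set i | `[< exists2 r, tensor_factors rho r &
                          mx_rsim (r i) (one_grepr F [set: gT]%G) >]].

Definition repr_weight (rho : representation F [set: gpow gT n]%G) : nat :=
  (n - #|triv_set rho|)%N.

End TensorFactors.

Section CosetRepresentation.
Variables (F : fieldType) (gT : finGroupType) (H : {group gT}).

Local Notation cosets := (lcosets H [set: gT]).

(* Matrix, acting on column vectors, of the action of g on the basis of left
   cosets of H: column j has its 1 in the row of the coset g * enum_val j. *)
Definition coset_mx (g : gT) : 'M[F]_#|cosets| :=
  \matrix_(i, j) (enum_val i == (g *: enum_val j)%g)%:R.

Lemma coset_mx_repr : mx_repr [set: gT]%G coset_mx.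
Proof.
split=> [|g h _ _].
  apply/matrixP=> i j; rewrite !mxE lcoset1.
  by rewrite (inj_eq enum_val_inj).
apply/matrixP=> i k; rewrite !mxE.
have hk : (h *: enum_val k)%g \in cosets.
  have /lcosetsP[x _ ->] := enum_valP k.
  by apply/lcosetsP; exists (h * x)%g; rewrite ?inE // lcosetM.
rewrite (bigD1 (enum_rank_in hk (h *: enum_val k)%g)) //= !mxE.
rewrite enum_rankK_in // eqxx mulr1 big1 ?addr0.
  by rewrite lcosetM.
move=> j jNh; rewrite !mxE.
case: (_ =P (h *: enum_val k)%g) => [jE|]; last by rewrite mulr0.
by case/eqP: jNh; apply: enum_val_inj; rewrite enum_rankK_in.
Qed.

Definition coset_grepr : representation F [set: gT]%G :=
  Representation (MxRepresentation coset_mx_repr).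

End CosetRepresentation.

Section Multiset.
Variables (F : fieldType) (gT : finGroupType) (n m : nat).

(* The family rho, seen as a multiset of m representations. *)
Definition irr_decomposition (H : {group gpow gT n})
    (rho : 'I_m -> representation F [set: gpow gT n]%G) : Prop :=
  (forall k, mx_irreducible (rho k)) /\
  mx_rsim (coset_grepr F H) (\big[@dadd_grepr F _ _/@grepr0 F _ _]_(k < m) rho k).

Definition repr_enum (K : fieldType)
    (rho : 'I_m -> representation F [set: gpow gT n]%G) (t : K) : K :=
  \sum_(k < m) (rdegree (rho k))%:R * t ^+ repr_weight (rho k).

End Multiset.

(* Main.v *)
(* For a set S of coordinates let Gamma_S be the normal subgroup of the tuples
   supported on S, and compute the dimension of the space of Gamma_S-invariants
   of C[Gamma^n / H] in two ways, as the trace of the averaging operator. On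
   cosets it is |Gamma^n : H| |Gamma_S :&: H| / |Gamma_S|. On an irreducible rho
   Schur's lemma makes it dim rho if Gamma_S acts trivially and 0 otherwise, and
   Gamma_S acts trivially exactly when S is contained in triv(rho). Hence
     |H| * sum_(rho, S <= triv(rho)) dim rho = q^(n - |S|) |Gamma_S :&: H|,
   and summing these identities over S with weight (1-t)^|S| t^(n-|S|) gives the
   theorem, because t^(n-|T|) and (1-t)^w (1+(q-1)t)^(n-w) are both products of
   sums that expand over S. That triv(rho) reads off which coordinates act
   trivially uses that every irreducible of Gamma^n is a tensor product. *)
Require Import Defs.
From HB Require Import structures.
From mathcomp Require Import all_boot all_order all_fingroup all_algebra.
From mathcomp Require Import mxrepresentation character fraction complex.
From mathcomp Require Import boolp reals exp.
From mathcomp Require Import ring.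

Set Implicit Arguments.
Unset Strict Implicit.
Unset Printing Implicit Defensive.

Import Order.TTheory GRing.Theory Num.Theory.
Local Open Scope ring_scope.

(** * Entries of Kronecker products *)

Section TensorEntries.
Variable F : fieldType.

(* The index pair hidden in a row or column index of [tprod]. *)
Fixpoint tidx m1 m2 : 'I_(m1 * m2) -> 'I_m1 * 'I_m2 :=
  match m1 with
  | 0 => fun i => let: Ordinal _ lt_i_0 := i in False_rect _ (notF lt_i_0)
  | m.+1 => fun i : 'I_(m2 + m * m2) =>
      match split i with
      | inl a => (ord0, a)
      | inr b => (lift ord0 (tidx b).1, (tidx b).2)
      end
  end.

Lemma tidx_inj m1 m2 : injective (@tidx m1 m2).
Proof.
elim: m1 => [|m1 IH] k l /=; first by case: k.
rewrite -[k](@splitK m2 (m1 * m2)%N) -[l](@splitK m2 (m1 * m2)%N) !unsplitK.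
case: (split _) => a; case: (split _) => b [] //=.
- by move=> ->.
- move=> E1 E2; congr (rshift _ _); apply: IH.
  by rewrite [LHS]surjective_pairing [RHS]surjective_pairing E2 (ord_inj E1).
Qed.

Lemma tidx_surj m1 m2 (p : 'I_m1 * 'I_m2) : exists i, tidx i = p.
Proof.
have [|g _ gK] := inj_card_bij (@tidx_inj m1 m2); last by exists (g p).
by rewrite card_prod !card_ord.
Qed.

Lemma trow_entry n1 (A : 'rV[F]_n1) m2 n2 (B : 'M[F]_(m2, n2)) i j :
  trow A B i j = A 0 (tidx j).1 * B i (tidx j).2.
Proof.
elim: n1 A j => [|n1 IH] A j /=; first by case: j.
rewrite mxE; case: (split j) => a /=; rewrite ?mxE //.
  by congr (A _ _ * _); apply: val_inj.
by rewrite IH mxE; congr (A _ _ * _); apply: val_inj.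
Qed.

Lemma tprod_entry m1 n1 (A : 'M[F]_(m1, n1)) m2 n2 (B : 'M[F]_(m2, n2)) i j :
  tprod A B i j = A (tidx i).1 (tidx j).1 * B (tidx i).2 (tidx j).2.
Proof.
elim: m1 A i => [|m1 IH] A i /=; first by case: i.
rewrite mxE; case: (split i) => a /=.
  by rewrite trow_entry mxE; congr (A _ _ * _); apply: val_inj.
by rewrite IH mxE; congr (A _ _ * _); apply: val_inj.
Qed.

(** Matrix units are pure tensors, so pure tensors span all matrices. *)
Lemma tprod_delta m1 m2 (i j : 'I_(m1 * m2)) :
  delta_mx i j = tprod (delta_mx (tidx i).1 (tidx j).1)
                       (delta_mx (tidx i).2 (tidx j).2) :> 'M[F]__.
Proof.
apply/matrixP=> k l; rewrite tprod_entry !mxE -natrM mulnb andbACA.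
by rewrite -!(inj_eq (@tidx_inj _ _)) -!pair_eqE.
Qed.

(** Entry [(a, b)] of [A] reappears in the product at two indices sharing a second coordinate [c],
    which exists because [m2] is positive. *)
Lemma tprod1_cancell m1 m2 (A : 'M[F]_m1) :
  (0 < m2)%N -> tprod A (1%:M : 'M_m2) = 1%:M -> A = 1%:M.
Proof.
move=> m2_gt0 E; apply/matrixP=> a b; pose c := Ordinal m2_gt0.
have [[i Ei] [j Ej]] := (tidx_surj (a, c), tidx_surj (b, c)).
move/matrixP/(_ i j): E; rewrite tprod_entry Ei Ej /= !mxE eqxx mulr1 => ->.
by rewrite -(inj_eq (@tidx_inj _ _)) Ei Ej xpair_eqE eqxx andbT.
Qed.

Lemma tprod1_cancelr m1 m2 (B : 'M[F]_m2) :
  (0 < m1)%N -> tprod (1%:M : 'M_m1) B = 1%:M -> B = 1%:M.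
Proof.
move=> m1_gt0 E; apply/matrixP=> a b; pose c := Ordinal m1_gt0.
have [[i Ei] [j Ej]] := (tidx_surj (c, a), tidx_surj (c, b)).
move/matrixP/(_ i j): E; rewrite tprod_entry Ei Ej /= !mxE eqxx mul1r => ->.
by rewrite -(inj_eq (@tidx_inj _ _)) Ei Ej xpair_eqE eqxx.
Qed.

Lemma tprod_suml (I : finType) (P : pred I) m1 n1 m2 n2
    (A : I -> 'M[F]_(m1, n1)) (B : 'M[F]_(m2, n2)) :
  tprod (\sum_(i | P i) A i) B = \sum_(i | P i) tprod (A i) B.
Proof.
apply/matrixP=> i j; rewrite tprod_entry !summxE mulr_suml.
by apply: eq_bigr => k _; rewrite tprod_entry.
Qed.

Lemma tprod_sumr (I : finType) (P : pred I) m1 n1 m2 n2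
    (A : 'M[F]_(m1, n1)) (B : I -> 'M[F]_(m2, n2)) :
  tprod A (\sum_(i | P i) B i) = \sum_(i | P i) tprod A (B i).
Proof.
apply/matrixP=> i j; rewrite tprod_entry !summxE mulr_sumr.
by apply: eq_bigr => k _; rewrite tprod_entry.
Qed.

Lemma tprodZl m1 n1 m2 n2 a (A : 'M[F]_(m1, n1)) (B : 'M[F]_(m2, n2)) :
  tprod (a *: A) B = a *: tprod A B.
Proof. by apply/matrixP=> i j; rewrite !(tprod_entry, mxE) mulrA. Qed.

Lemma tprodZr m1 n1 m2 n2 a (A : 'M[F]_(m1, n1)) (B : 'M[F]_(m2, n2)) :
  tprod A (a *: B) = a *: tprod A B.
Proof. by apply/matrixP=> i j; rewrite !(tprod_entry, mxE) mulrCA. Qed.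

End TensorEntries.

(** * Schur's lemma and traces *)

Section Irreducible.
Variables (F : fieldType) (gT : finGroupType) (G : {group gT}).

(** The image of [X] is a nonzero submodule of [r2] and its kernel a proper submodule of [r1], so
    [X] is full and free, hence square and invertible. *)
Lemma mx_Schur_rsim n1 n2 (r1 : mx_representation F G n1)
    (r2 : mx_representation F G n2) (X : 'M_(n1, n2)) :
    mx_irreducible r1 -> mx_irreducible r2 ->
    (forall x, x \in G -> r1 x *m X = X *m r2 x) -> X != 0 ->
  mx_rsim r1 r2.
Proof.
move=> /mx_irrP[n1_gt0 irr1] /mx_irrP[n2_gt0 irr2] homX nzX.
have fullX : row_full X.
  have modX : mxmodule r2 <<X>>%MS.
    rewrite (eqmx_module _ (genmxE _)).
    by apply/mxmoduleP=> x Gx; rewrite -homX // submxMl.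
  have nzU : <<X>>%MS != 0 by rewrite -mxrank_eq0 genmxE mxrank_eq0.
  by have := irr2 _ modX nzU; rewrite /row_full genmxE.
have freeX : row_free X.
  rewrite -kermx_eq0; apply: contraTT nzX => nzK; rewrite negbK.
  have modK : mxmodule r1 (kermx X).
    apply/mxmoduleP=> x Gx; apply/sub_kermxP.
    by rewrite -mulmxA homX // mulmxA mulmx_ker mul0mx.
  have /row_fullP[B BK] := irr1 _ modK nzK.
  by rewrite -[X]mul1mx -BK -mulmxA mulmx_ker mulmx0.
by exists X => //; rewrite -(eqP fullX) (eqP freeX).
Qed.

Lemma irr_trivial_rsim1 n (r : mx_representation F G n) :
  mx_irreducible r -> (forall x, x \in G -> r x = 1%:M) ->
  mx_rsim r (one_grepr F G).
Proof.
move=> /[dup] irr_r /mx_irrP[n_gt0 irr] r1.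
have irr1 : mx_irreducible (one_grepr F G).
  exact/mx_abs_irrW/linear_mx_abs_irr.
(* Under a trivial action every linear map to the trivial module is equivariant; the all-ones column
   is a nonzero one. *)
pose X : 'M[F]_(n, 1) := const_mx 1.
apply: (mx_Schur_rsim (X := X)) => // [x Gx|].
  by rewrite r1 // mul1mx mulmx1.
apply/eqP=> /matrixP/(_ (Ordinal n_gt0) 0)/eqP.
by rewrite !mxE oner_eq0.
Qed.

Lemma rsim1_trivial n (r : mx_representation F G n) x :
  mx_rsim r (one_grepr F G) -> x \in G -> r x = 1%:M.
Proof.
by move=> /mx_rsim_sym sim Gx; apply: (mx_rsim_scalar Gx sim).
Qed.

Lemma mxtrace_dadd_big (I : Type) (s : seq I) (r : I -> representation F G) x :
  \tr ((\big[@dadd_grepr F _ _/@grepr0 F _ _]_(k <- s) r k) x)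
    = \sum_(k <- s) \tr (r k x).
Proof.
elim: s => [|k s IH]; first by rewrite !big_nil mxtrace1.
by rewrite !big_cons mxtrace_block IH.
Qed.

Lemma mxtrace_regular_repr x : x \in G ->
  \tr (regular_repr F G x) = #|G|%:R *+ (x == 1%g).
Proof.
move=> Gx; have [-> | ntx] := eqVneq x 1%g.
  by rewrite repr_mx1 mxtrace1.
(* Translation by [x != 1] fixes no basis element, so the diagonal vanishes. *)
rewrite [\tr _]big1 // => k _; rewrite 2!mxE /=.
rewrite -(inj_eq enum_val_inj) gring_indexK ?groupM ?enum_valP //.
by rewrite eq_mulVg1 mulKg (negbTE ntx).
Qed.

(* For [N] normal, the average of [r] over [N] commutes with [r], so by Schur's
   lemma it is either 0 or invertible, and in the latter case absorbing [r x]
   for [x] in [N] shows that [r x] is the identity. *)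
Lemma mxtrace_sum_normal n (r : mx_representation F G n) (N : {group gT}) :
  mx_irreducible r -> (N <| G)%g ->
  \sum_(x in N) \tr (r x) = (#|N| * n * (N \subset rker r))%:R.
Proof.
move=> irr /andP[sNG nNG]; have [/subsetP kN | nkN] := boolP (N \subset rker r).
  rewrite muln1 (eq_bigr (fun=> n%:R)) => [|x Nx].
    by rewrite sumr_const natrM mulr_natl.
  by have /rkerP[_ ->] := kN x Nx; rewrite mxtrace1.
rewrite muln0 -raddf_sum /=; set P := \sum_(x in N) r x.
have [-> | nzP] := eqVneq P 0; first by rewrite mxtrace0.
have cP : centgmx r P.
  apply/centgmxP=> x Gx; rewrite mulmx_suml mulmx_sumr.
  rewrite [RHS](reindex_inj (conjg_inj x)) /=.
  apply: eq_big => [y | y Ny]; first by rewrite memJ_norm // (subsetP nNG).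
  have Gy := subsetP sNG y Ny.
  by rewrite -!repr_mxM ?groupJ // conjgC.
case/negP: nkN; apply/subsetP=> x Nx; apply/rkerP; split.
  exact: (subsetP sNG).
have uP := mx_Schur irr cP nzP.
apply: (can_inj (mulKmx uP)); rewrite mulmx1 mulmx_suml.
rewrite [RHS](reindex_inj (mulIg x)) /=.
apply: eq_big => [y | y Ny]; first by rewrite groupMr.
by rewrite repr_mxM // (subsetP sNG).
Qed.

End Irreducible.

(** * Tensor products over the coordinates *)

Section TensorPower.
Variables (F : fieldType) (gT : finGroupType) (n : nat).
Local Notation Gn := [set: gpow gT n]%G.
Implicit Types (r : 'I_n -> representation F [set: gT]%G) (s : seq 'I_n).
Implicit Types g : gpow gT n.

(** The list of coordinates is a parameter so that properties of [tensor_grepr] can be proved by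
    induction on it. *)
Definition tensor_seq s r : representation F Gn :=
  \big[@prod_grepr F _ _/one_grepr F _]_(i <- s) proj_grepr i (r i).

Lemma tensor_seq_cons j s r :
  tensor_seq (j :: s) r = prod_grepr (proj_grepr j (r j)) (tensor_seq s r).
Proof. by rewrite /tensor_seq big_cons. Qed.

Lemma mxtrace_tensor_seq s r g :
  \tr (tensor_seq s r g) = \prod_(i <- s) \tr (r i (g i)).
Proof.
elim: s => [|j s IH]; first by rewrite /tensor_seq !big_nil mxtrace1.
by rewrite tensor_seq_cons big_cons mxtrace_prod IH.
Qed.

Lemma rdegree_tensor_seq s r :
  (forall i, (0 < rdegree (r i))%N) -> (0 < rdegree (tensor_seq s r))%N.
Proof.
move=> r_gt0; elim: s => [|j s IH]; first by rewrite /tensor_seq big_nil.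
by rewrite tensor_seq_cons muln_gt0 r_gt0.
Qed.

Lemma tensor_seq_trivial s r g :
  (forall i, i \in s -> r i (g i) = 1%:M) -> tensor_seq s r g = 1%:M.
Proof.
elim: s => [|j s IH] r1; first by rewrite /tensor_seq big_nil.
rewrite tensor_seq_cons /= r1 ?mem_head // IH ?tprod1 // => i si.
by rewrite r1 // inE si orbT.
Qed.

Lemma eq_tensor_seq s r g g' :
  (forall i, i \in s -> g i = g' i) -> tensor_seq s r g = tensor_seq s r g'.
Proof.
elim: s => [|j s IH] eq_g; first by rewrite /tensor_seq big_nil.
rewrite tensor_seq_cons /= eq_g ?mem_head // IH // => i si.
by rewrite eq_g // inE si orbT.
Qed.

(** All factors other than [i] are identities, and identities of positive size cancel. Were [i]
    repeated in [s], a factor -1 could cancel itself. *)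
Lemma tensor_seq_trivial_factor s r g i :
    (forall i, (0 < rdegree (r i))%N) -> uniq s -> i \in s ->
    (forall j, j != i -> g j = 1%g) ->
  tensor_seq s r g = 1%:M -> r i (g i) = 1%:M.
Proof.
move=> r_gt0 + + g1; elim: s => [|j s IH] //= /andP[sj us].
rewrite tensor_seq_cons inE /=; have [ij _ | ij /= si] := eqVneq i j.
  rewrite -{j}ij in sj *.
  rewrite (@tensor_seq_trivial s r g); last first.
    move=> k sk; rewrite g1 ?repr_mx1 //.
    by apply: contraNneq sj => <-.
  by move/tprod1_cancell; apply; apply: rdegree_tensor_seq.
rewrite (g1 j) 1?eq_sym // repr_mx1 => /tprod1_cancelr E.
by apply: IH => //; apply: E.
Qed.

(** Tuples supported at the head [j] put every [tprod A 1] in the enveloping algebra, tuples trivial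
    at [j] every [tprod 1 B]; their products include all matrix units. *)
Lemma tensor_seq_full s r X :
    uniq s -> (forall i, mx_absolutely_irreducible (r i)) ->
  (X \in enveloping_algebra_mx (tensor_seq s r))%MS.
Proof.
move=> + irr; elim: s X => [|j s IH] X /=.
  move=> _; move: X; rewrite /tensor_seq big_nil => X.
  rewrite [X]mx11_scalar -scalemx1 linearZ scalemx_sub //.
  exact: envelop_mx1.
case/andP=> sj us; move: X; rewrite tensor_seq_cons => X.
set E := enveloping_algebra_mx _.
have subl A : (tprod A 1%:M \in E)%MS.
  have /mx_abs_irrP[_ [a aE]] := irr j; rewrite [A]aE.
  rewrite tprod_suml linear_sum summx_sub // => x _.
  rewrite tprodZl linearZ scalemx_sub //.
  pose y : gpow gT n := [ffun i => if i == j then x else 1%g].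
  have := envelop_mx_id (prod_grepr (proj_grepr j (r j)) (tensor_seq s r))
    (in_setT y : y \in Gn).
  rewrite /= ffunE eqxx tensor_seq_trivial // => i si.
  by rewrite ffunE ifN ?repr_mx1 //; apply: contraNneq sj => <-.
have subr B : (tprod 1%:M B \in E)%MS.
  have /envelop_mxP[a ->] := IH B us.
  rewrite tprod_sumr linear_sum summx_sub // => x _.
  rewrite tprodZr linearZ scalemx_sub //.
  pose y : gpow gT n := [ffun i => if i == j then 1%g else x i].
  have := envelop_mx_id (prod_grepr (proj_grepr j (r j)) (tensor_seq s r))
    (in_setT y : y \in Gn).
  rewrite /= ffunE eqxx repr_mx1 (@eq_tensor_seq s r y x) // => i si.
  by rewrite ffunE ifN //; apply: contraNneq sj => <-.
rewrite [X]matrix_sum_delta !linear_sum summx_sub // => i _.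
rewrite linear_sum summx_sub // => k _; rewrite linearZ scalemx_sub //.
by rewrite tprod_delta -[delta_mx (_ i).1 _]mulmx1 -[delta_mx (_ i).2 _]mul1mx
   tprodE envelop_mxM.
Qed.

End TensorPower.

Lemma tensor_grepr_abs_irr (F : fieldType) (gT : finGroupType) n
    (r : 'I_n -> representation F [set: gT]%G) :
  (forall i, mx_absolutely_irreducible (r i)) ->
  mx_absolutely_irreducible (tensor_grepr r).
Proof.
move=> irr; apply/andP; split.
  by apply: rdegree_tensor_seq => i; case/andP: (irr i).
rewrite -sub1mx; apply/row_subP=> i; rewrite -[row i _]vec_mxK.
by apply: tensor_seq_full => //; apply: index_enum_uniq.
Qed.

(** * Irreducibles of the power are tensor products *)

Section ClosedField.
Variables (F : closedFieldType) (gT : finGroupType) (n : nat).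
Hypothesis F_char0 : [pchar F] =i pred0.
Local Notation Gn := [set: gpow gT n]%G.

(* The indicator of 1 on [gT] is a combination of irreducible characters, so its
   [n]-th power is a combination of traces of tensors; convolving the matrix
   coefficients of [rho] with it gives 1, so one of these tensors is not
   orthogonal to [rho]. *)
Lemma tensor_factors_exist (rho : representation F Gn) :
  mx_irreducible rho -> exists r, tensor_factors rho r.
Proof.
move=> irr_rho.
(* The socle components of the regular representation index the irreducibles of [gT]; [f] below
   picks one per coordinate. *)
pose sG := DecSocleType (regular_repr F [set: gT]%G).
pose R (f : {ffun 'I_n -> sG}) i :=
  Representation (socle_repr (f i)) : representation F [set: gT]%G.
have irrR f i : mx_irreducible (R f i) by apply: socle_irr.
have irrT f : mx_irreducible (tensor_grepr (R f)).
  apply/mx_abs_irrW/tensor_grepr_abs_irr => i.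
  exact: group_closure_closed_field.
have [[f nz] | zf] := pselect (exists f,
    \sum_(g : gpow gT n) \tr (tensor_grepr (R f) g^-1%g) *: rho g != 0).
  exists (R f); split=> //; apply/mx_rsim_sym.
  set T := tensor_grepr (R f) in nz *.
  apply: contrapT => nsim; case/eqP: nz; apply/matrixP=> a b.
  (* The averaged matrix unit intertwines the tensor with [rho], so it vanishes by Schur if they are
     not equivalent. *)
  have zX c : \sum_(g : gpow gT n) T g^-1%g *m delta_mx c a *m rho g = 0.
    apply: contrapT => /eqP nzX; apply: nsim.
    apply: (mx_Schur_rsim (irrT f) irr_rho _ nzX) => x _.
    rewrite mulmx_sumr mulmx_suml [LHS](reindex_inj (mulIg x)) /=.
    apply: eq_bigr => g _.
    rewrite invMg mulmxA mulmxA -repr_mxM ?inE // mulKVg.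
    by rewrite -[RHS]mulmxA -repr_mxM ?inE.
  (* Entry [(c, b)] of the average for [c] carries the [c]-th diagonal entry of [T g^-1] times entry
     [(a, b)] of [rho g]; summing over [c] gives the trace. *)
  transitivity (\sum_c (\sum_(g : gpow gT n)
      T g^-1%g *m delta_mx c a *m rho g) c b); last first.
    by rewrite big1 ?mxE // => c _; rewrite zX mxE.
  rewrite summxE; under [RHS]eq_bigr do rewrite summxE.
  rewrite exchange_big; apply: eq_bigr => g _ /=.
  rewrite mxE mulr_suml; apply: eq_bigr => c _.
  rewrite -(mul_delta_mx (0 : 'I_1)) mulmxA -mulmxA -colE -rowE.
  by rewrite mxE big_ord1 !mxE.
exfalso.
have nz1 : (#|gT| ^ n)%:R *: (1%:M : 'M[F]_(rdegree rho)) != 0.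
  have /mx_irrP[d_gt0 _] := irr_rho; rewrite scaler_eq0 negb_or.
  rewrite -mxrank_eq0 mxrank1 -lt0n d_gt0 andbT.
  by rewrite ((pcharf0P F).1 F_char0) expn_eq0 negb_and -lt0n (cardD1 1%g).
case/eqP: nz1.
(* Degrees are the multiplicities in the regular character, which is [#|gT|] at 1 and 0
   elsewhere. *)
pose c (f : {ffun 'I_n -> sG}) : F := \prod_i (irr_degree (f i))%:R.
transitivity (\sum_f c f *: \sum_(g : gpow gT n)
    \tr (tensor_grepr (R f) g^-1%g) *: rho g); last first.
  apply: big1 => f _; rewrite [X in _ *: X](_ : _ = 0) ?scaler0 //.
  by apply: contrapT => /eqP nz; apply: zf; exists f.
under [RHS]eq_bigr do rewrite scaler_sumr.
have delta (g : gpow gT n) : \sum_f c f * \tr (tensor_grepr (R f) g^-1%g)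
    = \prod_i (#|gT|%:R *+ (g i == 1%g)).
  transitivity (\prod_i \sum_(W : sG)
      (irr_degree W)%:R * \tr (socle_repr W ((g^-1)%g i))).
    rewrite bigA_distr_bigA; apply: eq_bigr => f _.
    by rewrite [\tr _]mxtrace_tensor_seq -big_split.
  apply: eq_bigr => i _; rewrite invg_ffun -invg_eq1 -cardsT.
  rewrite -mxtrace_regular_repr ?inE // (mxtrace_regular_pchar sG) ?inE //.
  - by apply: eq_bigr => W _; rewrite mulr_natl.
  - by apply/pgroup.pgroupP=> p _ _; rewrite inE F_char0.
  exact: group_closure_closed_field.
rewrite exchange_big (bigD1 1%g) //= [X in _ + X]big1 ?addr0 => [|g ntg].
  under eq_bigr do rewrite scalerA.
  rewrite -scaler_suml delta repr_mx1; congr (_ *: _).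
  under eq_bigr do rewrite oneg_ffun eqxx.
  by rewrite prodr_const card_ord natrX.
under eq_bigr do rewrite scalerA.
rewrite -scaler_suml delta; have [i ntgi] : exists i, g i != 1%g.
  apply/existsP; apply: contraNT ntg => /existsPn g1.
  by apply/eqP/ffunP=> i; rewrite oneg_ffun; apply/eqP; rewrite -[_ == _]negbK.
by rewrite (bigD1 i) //= (negbTE ntgi) mul0r scale0r.
Qed.

End ClosedField.

(** * Subgroups of tuples supported on a coordinate set *)

Section SupportSubgroup.
Variables (gT : finGroupType) (n : nat).
Implicit Types (S : {set 'I_n}) (g : gpow gT n).

Definition supp_group S : {group gpow gT n} :=
  setXn_group (fun i => if i \in S then [set: gT]%G else 1%G).

Lemma supp_groupP S g :
  reflect (forall i, i \notin S -> g i = 1%g) (g \in supp_group S).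
Proof.
apply: (iffP idP) => [/setXnP gS i /negbTE iS | gS].
  by have := gS i; rewrite iS => /set1P.
apply/setXnP=> i.
by case: ifPn => [_ | /gS ->]; rewrite ?inE.
Qed.

Lemma supp_group_normal S : (supp_group S <| [set: gpow gT n])%g.
Proof.
apply/andP; split; first exact: subsetT.
apply/subsetP=> x _; rewrite inE; apply/subsetP=> _ /imsetP[g /supp_groupP gS ->].
apply/supp_groupP=> i /gS g1.
by rewrite !mulg_ffun invg_ffun g1 mul1g mulVg.
Qed.

Lemma card_supp_group S : #|supp_group S| = (#|gT| ^ #|S|)%N.
Proof.
rewrite cardsXn (bigID (mem S)) /= [X in (_ * X)%N]big1 ?muln1.
  rewrite -prod_nat_const; apply: eq_bigr => i /= ->.
  by rewrite cardsT.
by move=> i /negbTE ->; rewrite cards1.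
Qed.

End SupportSubgroup.

(** * The trivial coordinates of an irreducible *)

Section TrivialFactors.
Variables (F : closedFieldType) (gT : finGroupType) (n : nat).
Hypothesis F_char0 : [pchar F] =i pred0.
Local Notation Gn := [set: gpow gT n]%G.

(** The left side does not mention [r], so whether a factor is trivial is independent of the
    factorization chosen. *)
Lemma tensor_factors_single (rho : representation F Gn) r i (g : gpow gT n) :
    tensor_factors rho r -> (forall j, j != i -> g j = 1%g) ->
  g \in rker rho = (r i (g i) == 1%:M).
Proof.
case=> irr_r sim g1; rewrite (rker_mx_rsim sim).
apply/rkerP/eqP=> [[_] | r1].
  apply: tensor_seq_trivial_factor => //; first 1 last.
  - exact: index_enum_uniq.
  - exact: mem_index_enum.
  by move=> j; have /mx_irrP[] := irr_r j.
split; rewrite ?inE //; apply: tensor_seq_trivial => j _.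
by have [-> // | ji] := eqVneq j i; rewrite g1 // repr_mx1.
Qed.

Lemma sub_triv_set (rho : representation F Gn) (S : {set 'I_n}) :
  mx_irreducible rho ->
  (S \subset triv_set rho) = (supp_group gT S \subset rker rho).
Proof.
move=> irr_rho; have [r rE] := tensor_factors_exist F_char0 irr_rho.
pose y i x : gpow gT n := [ffun j => if j == i then x else 1%g].
have yi i x : y i x i = x by rewrite ffunE eqxx.
have y1 i x j : j != i -> y i x j = 1%g by move=> ji; rewrite ffunE ifN.
apply/subsetP/subsetP=> [trivS g /supp_groupP gS | kerS i iS].
  rewrite (rker_mx_rsim rE.2); apply/rkerP; split; rewrite ?inE //.
  apply: tensor_seq_trivial => i _.
  have [iS | /gS -> ] := boolP (i \in S); last exact: repr_mx1.
  (* The factorization [r'] witnessing [i] may differ from [r] and vary with [i]; the kernel of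
     [rho] links the two. *)
  have := trivS i iS; rewrite inE => /asboolP[r' r'E triv_r'].
  apply/eqP; rewrite -(yi i (g i)) -(tensor_factors_single rE (y1 i _)).
  rewrite (tensor_factors_single r'E (y1 i _)) yi.
  by apply/eqP/(rsim1_trivial triv_r'); rewrite inE.
rewrite inE; apply/asboolP; exists r => //.
apply: irr_trivial_rsim1 => [|x _]; first exact: rE.1.
apply/eqP; rewrite -(yi i x) -(tensor_factors_single rE (y1 i _)) kerS //.
by apply/supp_groupP=> j jS; apply: y1; apply: contraNneq jS => ->.
Qed.

End TrivialFactors.

(** * Traces on the coset representation *)

Lemma card_coset_stabilizer (gT : finGroupType) (H N : {group gT}) (y : gT) :
  (N <| [set: gT])%g ->
  #|[set x in N | (x *: (y *: H) == y *: H)%g]| = #|N :&: H|%g.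
Proof.
case/andP=> _ /subsetP nN; rewrite -(card_imset _ (conjg_inj y)).
(* Conjugation by [y] carries the stabilizer of the coset in [N] onto [N :&: H]. *)
have stabE x : (x *: (y *: H) == y *: H)%g = (x ^ y \in H)%g.
  rewrite -lcosetM conjgE -mem_lcoset.
  by apply/eqP/idP => /lcoset_eqP.
apply: eq_card => z; apply/imsetP/setIP => [[x] | [Nz Hz]].
  by rewrite inE stabE => /andP[Nx Hx] ->; rewrite memJ_norm ?nN ?inE.
exists (z ^ y^-1)%g; last by rewrite conjgKV.
by rewrite inE stabE conjgKV Hz memJ_norm ?nN ?inE ?Nz.
Qed.

(** Each trace counts fixed cosets; exchanging the sums, each coset is fixed by [#|N :&: H|]
    elements of [N]. *)
Lemma mxtrace_coset_normal (F : fieldType) (gT : finGroupType)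
    (H N : {group gT}) : (N <| [set: gT])%g ->
  \sum_(x in N) \tr (coset_grepr F H x) = (#|[set: gT] : H|%g * #|N :&: H|%g)%:R.
Proof.
move=> nN.
rewrite /mxtrace exchange_big /= natrM -card_lcosets mulr_natl.
rewrite -[X in _ *+ X]card_ord -sumr_const; apply: eq_bigr => k _.
have /lcosetsP[y _ kE] := enum_valP k.
rewrite -(card_coset_stabilizer H y nN) -sum1_card natr_sum.
rewrite [RHS](eq_bigl (fun x => (x \in N) && (x *: (y *: H) == y *: H)%g)).
  rewrite big_mkcondr; apply: eq_bigr => x _.
  by rewrite mxE kE eq_sym; case: eqP.
by move=> x; rewrite inE.
Qed.

(** * Products expanded over subsets *)

Lemma prodr_if_mem (K : comPzRingType) n (S : {set 'I_n}) (a b : K) :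
  \prod_i (if i \in S then a else b) = a ^+ #|S| * b ^+ (n - #|S|).
Proof.
have -> : (n - #|S|)%N = #|~: S| by rewrite [RHS]cardsCs setCK card_ord.
rewrite (bigID (mem S)) /= -!prodr_const; congr (_ * _).
  by apply: eq_bigr => i ->.
by apply: eq_big => [i | i /negbTE ->] //; rewrite inE.
Qed.

(** In the expansion [S] collects the coordinates where the first summand is chosen; the other
    choices of [S] meet a zero factor. *)
Lemma prodr_add_if_mem (K : comPzRingType) n (T U : {set 'I_n}) (a b : K) :
  \prod_i ((if i \in T then a else 0) + (if i \in U then b else 0)) =
  \sum_(S : {set 'I_n} | (S \subset T) && (~: S \subset U))
     a ^+ #|S| * b ^+ (n - #|S|).
Proof.
rewrite bigA_distr [RHS]big_mkcond; apply: eq_bigr => S _.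
case: ifPn => [/andP[/subsetP ST /subsetP SU] | nS].
  rewrite -prodr_if_mem; apply: eq_bigr => i _.
  by case: ifPn => iS; rewrite ?(ST _ iS) // SU // inE.
suff [i iS]: exists i, (if i \in S then i \notin T else i \notin U).
  rewrite (bigD1 i) //=; case: ifP iS => _ /negbTE ->; exact: mul0r.
apply/existsP; apply: contraR nS => /existsPn nS.
apply/andP; split; apply/subsetP=> i.
  by move=> iS; have := nS i; rewrite iS negbK.
by rewrite inE => /negbTE iS; have := nS i; rewrite iS negbK.
Qed.

(** * The weight enumerator identity *)

Section MacWilliams.
Variables (C : numClosedFieldType) (gT : finGroupType) (n m : nat).
Variables (H : {group gpow gT n}).
Variable rho : 'I_m -> representation C [set: gpow gT n]%G.
Hypothesis rhoH : irr_decomposition H rho.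
Local Notation q := #|gT|.

(** This is an equation of natural numbers because traces live in [C] while the enumerators are
    evaluated in another field [K]. *)
Lemma sum_rdegree_sub_triv_set (S : {set 'I_n}) :
  (#|H| * \sum_(k < m | S \subset triv_set (rho k)) rdegree (rho k))%N
    = (q ^ (n - #|S|) * #|supp_group gT S :&: H|%g)%N.
Proof.
have [irr sim] := rhoH.
have q_gt0 : (0 < q)%N by rewrite (cardD1 1%g).
have := mxtrace_coset_normal C H (supp_group_normal gT S).
under eq_bigr => x _ do rewrite (mxtrace_rsim sim) ?inE // mxtrace_dadd_big.
rewrite exchange_big /=.
under eq_bigr => k _ do rewrite
  (mxtrace_sum_normal (irr k) (supp_group_normal gT S))
  -(sub_triv_set (@pchar_num C) _ (irr k)) card_supp_group.
rewrite -natr_sum => /eqP; rewrite eqr_nat => /eqP sumE.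
have leSn : (#|S| <= n)%N by have := max_card (mem S); rewrite card_ord.
have qS_gt0 : (0 < q ^ #|S|)%N by rewrite expn_gt0 q_gt0.
have cardG : (#|H| * #|[set: gpow gT n] : H|%g = q ^ n)%N.
  rewrite Lagrange ?subsetT //.
  transitivity #|supp_group gT [set: 'I_n]|.
    apply: eq_card => g; rewrite inE.
    by apply/esym/supp_groupP=> i; rewrite inE.
  by rewrite card_supp_group cardsT card_ord.
(* Multiplying by the order of the support subgroup completes [q ^ (n - #|S|)] to [q ^ n], the order
   of [H] times its index. *)
apply/eqP; rewrite -(eqn_pmul2l qS_gt0) [X in _ == X]mulnA -expnD subnKC //.
rewrite -cardG mulnCA -[X in _ == X]mulnA -sumE eqn_mul2l big_distrr.
apply/orP; right; apply/eqP; rewrite big_mkcond; apply: eq_bigr => k _ /=.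
by case: ifP => _; rewrite ?muln1 ?muln0.
Qed.

Lemma repr_enum_macwilliams (K : fieldType) (t : K) :
    #|H|%:R != 0 :> K -> 1 + (q%:R - 1) * t != 0 ->
  repr_enum rho t = (1 + (q%:R - 1) * t) ^+ n / #|H|%:R *
    code_enum H ((1 - t) / (1 + (q%:R - 1) * t)).
Proof.
move=> nzH; set D := 1 + _ => nzD.
apply: (mulfI nzH); rewrite mulrA mulrCA divff // mulr1.
transitivity (\sum_(S : {set 'I_n}) (1 - t) ^+ #|S| * t ^+ (n - #|S|) *
   (#|H| * \sum_(k < m | S \subset triv_set (rho k)) rdegree (rho k))%:R).
  under [RHS]eq_bigr do
    rewrite natrM mulrCA natr_sum big_mkcond mulr_sumr.
  rewrite -mulr_sumr exchange_big; congr (_ * _); apply: eq_bigr => k _ /=.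
  rewrite /repr_weight; move: (triv_set _) => T.
  (* A coordinate in [T] contributes [(1 - t) + t = 1], any other [t]. *)
  transitivity ((rdegree (rho k))%:R *
    \prod_(i < n) ((if i \in T then 1 - t else 0) +
                      (if i \in [set: 'I_n] then t else 0))).
    congr (_ * _); rewrite -[LHS]mul1r -[X in X * _](expr1n _ #|T|).
    rewrite -prodr_if_mem; apply: eq_bigr => i _.
    by rewrite inE; case: ifP; rewrite ?subrK ?add0r.
  rewrite prodr_add_if_mem big_mkcond mulr_sumr; apply: eq_bigr => S _.
  rewrite subsetT andbT; case: ifP => _; rewrite ?mulr0 //.
  exact: mulrC.
under eq_bigr do rewrite sum_rdegree_sub_triv_set.
(* Here [D ^+ n] clears the denominators of the substituted enumerator. *)
transitivity (\sum_(h in H) (1 - t) ^+ code_weight h *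
                                D ^+ (n - code_weight h)); last first.
  rewrite mulr_sumr; apply: eq_bigr => h _.
  have wn : (code_weight h <= n)%N by rewrite -[X in (_ <= X)%N]card_ord max_card.
  have -> : D ^+ n = D ^+ (n - code_weight h) * D ^+ code_weight h.
    by rewrite -exprD subnK.
  by rewrite expr_div_n mulrCA mulfK // expf_neq0.
transitivity (\sum_(h in H) \sum_(S : {set 'I_n})
   if h \in supp_group gT S
   then (1 - t) ^+ #|S| * (q%:R * t) ^+ (n - #|S|) else 0).
  rewrite exchange_big; apply: eq_bigr => S _ /=.
  rewrite -big_mkcondr (eq_bigl (mem (supp_group gT S :&: H)%g)) => [|h].
    by rewrite sumr_const -mulr_natl exprMn natrM natrX; ring.
  by rewrite !inE andbC.
apply: eq_bigr => h _; pose U := [set i | h i == 1%g].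
(* [h] lies in the support subgroup of [S] exactly when the complement of [S] is inside [U]. A
   coordinate in [U] contributes [1 - t + q t = D], any other [1 - t]. *)
transitivity (\prod_i ((if i \in [set: 'I_n] then 1 - t else 0) +
                        (if i \in U then q%:R * t else 0))).
  rewrite prodr_add_if_mem [RHS]big_mkcond; apply: eq_bigr => S _.
  rewrite subsetT /=; congr (if _ then _ else _).
  apply/supp_groupP/subsetP=> [hS i | SU i iS].
    by rewrite !inE => /hS ->.
  by have := SU i; rewrite !inE iS => /(_ isT)/eqP.
rewrite -prodr_if_mem; apply: eq_bigr => i _; rewrite !inE /D.
by case: eqP => _ /=; ring.
Qed.

End MacWilliams.

(** * The logarithmic rank and the field of rational functions *)

Lemma powR_log_rank (R : realType) (gT : finGroupType) (n : nat)
    (H : {group gpow gT n}) :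
  powR (#|gT|%:R) (log_rank R H) = #|H|%:R.
Proof.
have H_gt0 : (0 : R) < #|H|%:R by rewrite ltr0n cardG_gt0.
rewrite /powR /log_rank.
(* If [gT] is trivial, the power has base 1 and equals 1 whatever the exponent, and [H] has one
   element. *)
have [q1 | q_neq1] := eqVneq #|gT| 1%N.
  rewrite q1 oner_eq0 ln1 mulr0 expR0.
  have gT1 (x : gT) : x = 1%g.
    by have /card1P[y yE] := introT eqP q1; move: (yE x) (yE 1%g);
       rewrite !inE => /esym/eqP -> /esym/eqP ->.
  suff -> : H = 1%G by rewrite cards1.
  apply/trivGP/subsetP=> h _; apply/set1P/ffunP=> i.
  by rewrite oneg_ffun.
have q_gt1 : (1 < #|gT|)%N by rewrite ltn_neqAle eq_sym q_neq1 (cardD1 1%g).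
have lnq_gt0 : (0 : R) < ln #|gT|%:R by rewrite ln_gt0 // ltr1n.
rewrite pnatr_eq0 -leqn0 leqNgt (ltnW q_gt1) /=.
by rewrite divfK ?gt_eqF // lnK.
Qed.

Theorem theorem10p6 (R : realType) (gT : finGroupType) (n : nat) (hn : (1 <= n)%N)
    (H : {group gpow gT n}) (m : nat)
    (rho : 'I_m -> representation R[i] [set: gpow gT n]%G)
    (hrho : irr_decomposition H rho) :
  let q : nat := #|gT| in
  let t : {fraction {poly R}} := tofrac 'X in
  repr_enum rho t =
    (1 + (q%:R - 1) * t) ^+ n / tofrac (powR q%:R (log_rank R H))%:P *
    code_enum H ((1 - t) / (1 + (q%:R - 1) * t)).
Proof.
move=> q t; rewrite powR_log_rank rmorph_nat rmorph_nat.
have nz_frac (p : {poly R}) : p != 0 -> tofrac p != 0.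
  by rewrite tofrac_eq0.
apply: repr_enum_macwilliams => //.
  rewrite -(rmorph_nat (@tofrac _)) tofrac_eq0 -polyC_natr polyC_eq0.
  by rewrite pnatr_eq0 -lt0n cardG_gt0.
rewrite -(rmorph_nat (@tofrac {poly R})) -tofrac1 -tofracB -tofracM -tofracD.
(* The denominator is nonzero because as a polynomial it takes the value 1 at 0. *)
rewrite tofrac_eq0; apply/eqP=> /(congr1 (horner^~ 0))/eqP.
by rewrite !hornerE oner_eq0.
Qed.
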